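(* Let $\alpha_1,\alpha_2>0$ with $\alpha_1\neq\alpha_2$, and let $C$ be the Two-component copula with parameters $\alpha_1,\alpha_2$. Then $C$ is not symmetric, i.e. it is not true that $C(u,v)=C(v,u)$ for all $u,v\in[0,1]$; consequently $C$ is neither an Archimedean copula nor a Gaussian copula.
   Context: The Two-component copula with parameters $\alpha_1,\alpha_2>0$ is the function $C:[0,1]^2\to[0,1]$ given, for $(u_1,u_2)\in(0,1)^2$, by $$C(u_1,u_2)=u_1+u_2-1+\int_0^\infty F_{G_1}\!\left(\frac{w}{(1-u_1)^{-1/\alpha_1}-1}\right)F_{G_2}\!\left(\frac{w}{(1-u_2)^{-1/\alpha_2}-1}\right)e^{-w}\,dw,$$ with $C(u_1,1)=u_1$ for $u_1\in[0,1]$, $C(1,u_2)=u_2$ for $u_2\in[0,1)$, and $C=0$ at the remaining points of $[0,1]^2$. Here $F_{G_i}$ is the cumulative distribution function of $G_i\sim\Gamma(\alpha_i,1)$ (gamma distribution with shape $\alpha_i$ and rate $1$). An Archimedean copula is a function of the form $C(u,v)=\varphi^{[-1]}(\varphi(u)+\varphi(v))$ on $[0,1]^2$, where $\varphi:[0,1]\to[0,\infty]$ is continuous, strictly decreasing and convex with $\varphi(1)=0$, and the pseudo-inverse $\varphi^{[-1]}:[0,\infty]\to[0,1]$ equals $\varphi^{-1}(t)$ for $0\le t\le\varphi(0)$ and $0$ for $\varphi(0)\le t\le\infty$. A Gaussian copula is a copula of the form $$C(u,v)=\int_{-\infty}^{\Phi^{-1}(u)}\int_{-\infty}^{\Phi^{-1}(v)}\frac{1}{2\pi(1-\rho^2)^{1/2}}\exp\left(-\frac{s^2-2\rho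 st+t^2}{2(1-\rho^2)}\right)ds\,dt$$ with $\rho\in(-1,1)$, where $\Phi$ is the standard normal distribution function. *)

(* Defs.v *)
From HB Require Import structures.
From mathcomp Require Import all_boot all_order all_algebra.
From mathcomp Require Import all_classical all_reals all_analysis.

Set Implicit Arguments.
Unset Strict Implicit.
Unset Printing Implicit Defensive.

Import Order.TTheory GRing.Theory Num.Theory.
Import numFieldNormedType.Exports.

Local Open Scope classical_set_scope.
Local Open Scope ring_scope.

Section gamma_distribution.
Context {R : realType}.
Local Notation mu := (@lebesgue_measure R).

(* Euler's Gamma function at a; the integral converges only for 0 < a. *)
Definition gamma_fun (a : R) : R :=
  \int[mu]_(t in `]0, +oo[) (t `^ (a - 1) * expR (- t)).

Definition gamma_pdf (a : R) : R -> R :=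
  (fun t : R => t `^ (a - 1) * expR (- t) / gamma_fun a) \_ `]0, +oo[.

(* The law Gamma(a, 1): shape a, rate 1. *)
Definition gamma_prob (a : R) (V : set R) : \bar R :=
  (\int[mu]_(t in V) (gamma_pdf a t)%:E)%E.

Definition gamma_cdf (a x : R) : R := fine (gamma_prob a `]-oo, x]).

End gamma_distribution.

(* Functions on the unit square are represented by total functions
   R -> R -> R; values outside [0, 1]^2 are irrelevant. *)

Definition two_component_copula {R : realType} (a1 a2 u1 u2 : R) : R :=
  if (0 < u1 < 1) && (0 < u2 < 1) then
    u1 + u2 - 1 +
    \int[lebesgue_measure]_(w in `[0%R, +oo[)
      (gamma_cdf a1 (w / ((1 - u1) `^ (- a1^-1) - 1)) *
       gamma_cdf a2 (w / ((1 - u2) `^ (- a2^-1) - 1)) * expR (- w))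
  else if (0 <= u1 <= 1) && (u2 == 1) then u1
  else if (u1 == 1) && (0 <= u2 < 1) then u2
  else 0.

Section archimedean.
Context {R : realType}.

(* In \bar R, 0 * +oo = 0, so the convexity inequality is meaningful also when
   phi 0 = +oo. *)
Definition archimedean_generator (phi : R -> \bar R) : Prop :=
  [/\ forall u : R, u \in `[0%R, 1%R] -> (0 <= phi u)%E,
      {within `[0%R, 1%R], continuous phi},
      {in `[0%R, 1%R] &, forall x y : R, x < y -> (phi y < phi x)%E},
      forall t x y : R, t \in `[0%R, 1%R] -> x \in `[0%R, 1%R] ->
        y \in `[0%R, 1%R] ->
        (phi (t * x + (1 - t) * y)%R <= t%:E * phi x + (1 - t)%:E * phi y)%E
    & phi 1 = 0%E].

Definition pseudo_inverse (phi : R -> \bar R) (t : \bar R) : R :=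
  if (t <= phi 0%R)%E then 'pinv_(fun=> 0) `[0%R, 1%R] phi t else 0.

Definition is_archimedean_copula (C : R -> R -> R) : Prop :=
  exists phi : R -> \bar R, archimedean_generator phi /\
    forall u v : R, u \in `[0%R, 1%R] -> v \in `[0%R, 1%R] ->
      C u v = pseudo_inverse phi (phi u + phi v)%E.

End archimedean.

Section gaussian.
Context {R : realType}.
Local Notation mu := (@lebesgue_measure R).

(* The standard normal distribution function, extended to \bar R by 0 at -oo
   and 1 at +oo, so that it is a bijection from \bar R onto [0, 1]. *)
Definition std_normal_cdf (x : \bar R) : R :=
  fine (normal_prob 0 1 [set t : R | (t%:E <= x)%E]).

(* -oo at 0 and +oo at 1; the value 0 outside [0, 1] is a dummy. *)
Definition std_normal_quantile : R -> \bar R :=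
  'pinv_(fun=> 0%E) [set: \bar R] std_normal_cdf.

Definition binormal_pdf (rho s t : R) : R :=
  (2 * pi * Num.sqrt (1 - rho ^+ 2))^-1 *
  expR (- ((s ^+ 2 - 2 * rho * s * t + t ^+ 2) / (2 * (1 - rho ^+ 2)))).

Definition is_gaussian_copula (C : R -> R -> R) : Prop :=
  exists2 rho : R, -1 < rho < 1 &
    forall u v : R, u \in `[0%R, 1%R] -> v \in `[0%R, 1%R] ->
      (C u v)%:E =
      (\int[mu]_(t in [set t : R | t%:E <= std_normal_quantile u])
         \int[mu]_(s in [set s : R | s%:E <= std_normal_quantile v])
           (binormal_pdf rho s t)%:E)%E.

End gaussian.

(* Main.v *)
Require Import Defs.
From mathcomp Require Import all_boot all_order all_algebra.
From mathcomp Require Import all_classical all_reals all_analysis.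
From mathcomp Require Import measurable_realfun.
From mathcomp Require Import ring lra.

Import Order.TTheory GRing.Theory Num.Theory.
Import numFieldNormedType.Exports.
Local Open Scope classical_set_scope.
Local Open Scope ring_scope.

(** Let G1, G2 ~ Gamma(a1, 1), Gamma(a2, 1) and W ~ Exp(1) be independent, let
    0 < s, t and x_i(s) = exp(s / a_i) - 1.  At u = 1 - exp(-s),
    v = 1 - exp(-t) the copula is u + v - 1 + P(G1 < W / x1(s), G2 < W / x2(t)).
    The marginal law P(G_i < W / x_i(s)) is split off from this probability, so
    symmetry of C says that
      P(G1 < W / x1(s)) - P(G1 < W / x1(s), G2 >= W / x2(t))
    is unchanged when the indices 1 and 2 are exchanged.  For t -> 0 the joint
    terms vanish, so the marginal terms agree, hence the joint terms agree too.
    But for fixed s the first joint term is of order t^(1 + a1), because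
    G2 >= W / x2(t) forces W = O(t), and G1 < W / x1(s) then has probability
    of order W^a1; the exchanged term is of order t^(1 + a2).
    Archimedean and Gaussian copulas are symmetric. *)

(** * Convergence of Euler's Gamma integral *)

Section gamma_integral.
Context {R : realType}.
Local Notation mu := (@lebesgue_measure R).
Local Notation pos := (`]0, +oo[%classic : set R).

Definition gamma_integrand (a t : R) : R := t `^ (a - 1) * expR (- t).

Lemma measurable_gamma_integrand (a : R) (D : set R) :
  measurable_fun D (gamma_integrand a).
Proof.
apply: measurable_funTS; apply: measurable_funM; first exact: measurable_powR.
by apply: measurableT_comp => //; exact: oppr_measurable.
Qed.

Lemma gamma_integrand_ge0 (a t : R) : 0 <= gamma_integrand a t.
Proof. by rewrite mulr_ge0 ?powR_ge0 ?expR_ge0. Qed.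

(** This is t / m <= exp(t / m) raised to the power m. *)
Lemma powR_le_expR (m t : R) : 0 < m -> 0 < t -> t `^ m <= m `^ m * expR t.
Proof.
move=> m0 t0.
have -> : t `^ m = m `^ m * (t / m) `^ m.
  rewrite -powRM ?(ltW m0) ?divr_ge0 ?(ltW t0)//; last exact: ltW.
  by rewrite mulrCA divff ?mulr1 ?gt_eqF.
rewrite ler_wpM2l ?powR_ge0//.
have -> : expR t = (expR (t / m)) `^ m.
  by rewrite -expRM divfK// gt_eqF.
rewrite ge0_ler_powR ?nnegrE ?(ltW m0) ?expR_ge0 ?divr_ge0 ?(ltW t0)//.
  exact: ltW.
by apply: le_trans (expR_ge1Dx _); rewrite lerDr.
Qed.

(* (t / (1 + t))^a is bounded, and a multiple of its derivative dominates the
   Gamma integrand on ]0, +oo[. *)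
Let G (a t : R) := (1 - (1 + t)^-1) `^ a.
Let g (a t : R) := a * (1 - (1 + t)^-1) `^ (a - 1) * (1 + t) ^- 2.

Let ratio_gt0 (x : R) : 0 < x -> 0 < 1 - (1 + x)^-1.
Proof.
by move=> x0; rewrite subr_gt0 invf_lt1 ?ltrDl ?addr_gt0.
Qed.

Let is_derive_G (a x : R) : 0 < x -> is_derive x 1 (G a) (g a x).
Proof.
move=> x0; rewrite /G /g.
have x1 : 0 < 1 + x by rewrite addr_gt0.
have d1 : is_derive x 1 (fun t : R => 1 - (1 + t)^-1) ((1 + x) ^- 2).
  have d2 : is_derive x 1 (fun t : R => 1 + t) 1.
    have := is_deriveD (is_derive_cst (1 : R) x 1) (is_derive_id x 1).
    by rewrite add0r.
  have d3 := is_deriveV (lt0r_neq0 x1) d2.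
  have := is_deriveB (is_derive_cst (1 : R) x 1) d3.
  by rewrite scaleNr opprK add0r /GRing.scale/= mulr1.
have d2 := is_derive1_powR a (ratio_gt0 _ x0).
exact: (@is_derive1_comp _ (@powR R ^~ a) (fun t : R => 1 - (1 + t)^-1) _ _ _ d2 d1).
Qed.

Let g_ge0 (a t : R) : 0 <= a -> 0 <= g a t.
Proof.
move=> a0; rewrite !mulr_ge0 ?powR_ge0//.
by rewrite invr_ge0 sqr_ge0.
Qed.

(** Since 1 - 1 / (1 + t) = t / (1 + t), [g a t] equals a t^(a-1) (1 + t)^(-a-1). The comparison is
    thus [powR_le_expR] with m = a + 1 at the point 1 + t, whose constant gives K. *)
Let gamma_le_g (a : R) : 0 < a ->
  exists2 K, 0 <= K & forall t, 0 < t -> gamma_integrand a t <= K * g a t.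
Proof.
move=> a0; exists ((a + 1) `^ (a + 1) * expR 1 / a).
  by rewrite divr_ge0 ?mulr_ge0 ?powR_ge0 ?expR_ge0 ?ltW.
move=> t t0; rewrite /g /gamma_integrand.
have t1 : 0 < 1 + t by rewrite addr_gt0.
have -> : 1 - (1 + t)^-1 = t / (1 + t).
  by field; rewrite gt_eqF.
rewrite powRM ?(ltW t0) ?invr_ge0 ?(ltW t1)//.
have -> : (1 + t)^-1 `^ (a - 1) = (1 + t) `^ (- (a + 1)) * (1 + t) ^+ 2.
  rewrite -(powR_inv1 (ltW t1)) -powRrM mulN1r -powR_mulrn ?(ltW t1)//.
  by rewrite -powRD; [congr (_ `^ _); ring | rewrite (gt_eqF t1) implybT].
have -> : (a + 1) `^ (a + 1) * expR 1 / a *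
   (a * (t `^ (a - 1) * ((1 + t) `^ (- (a + 1)) * (1 + t) ^+ 2)) * (1 + t) ^- 2)
   = t `^ (a - 1) * ((a + 1) `^ (a + 1) * expR 1 / (1 + t) `^ (a + 1)).
  rewrite powRN; field; rewrite gt_eqF ?powR_gt0//=.
  by rewrite (gt_eqF a0) (gt_eqF t1).
rewrite ler_wpM2l ?powR_ge0// ler_pdivlMr ?powR_gt0//.
rewrite mulrC expRN ler_pdivrMr ?expR_gt0// -mulrA -expRD.
by apply: powR_le_expR => //; rewrite addr_gt0.
Qed.

Let continuous_g (a x : R) : 0 < x -> {for x, continuous (g a)}.
Proof.
move=> x0.
have x1 : 0 < 1 + x by rewrite addr_gt0.
have cD : (1 + t) @[t --> x] --> 1 + x.
  by apply: cvgD; [exact: cvg_cst | exact: cvg_id].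
have cV : (1 + t)^-1 @[t --> x] --> (1 + x)^-1.
  by apply: cvgV => //; rewrite gt_eqF.
have cI : (1 + t) ^- 2 @[t --> x] --> (1 + x) ^- 2.
  by under eq_fun do rewrite -exprVn expr2; rewrite -exprVn expr2; apply: cvgM.
have cP : {for x, continuous (fun t : R => (1 - (1 + t)^-1) `^ (a - 1))}.
  apply: (continuous_comp (f := fun t : R => 1 - (1 + t)^-1) (g := @powR R ^~ (a - 1))).
    by apply: cvgB; [exact: cvg_cst | exact: cV].
  apply: differentiable_continuous; apply/derivable1_diffP.
  by have [] := is_derive1_powR (a - 1) (ratio_gt0 _ x0).
exact: (cvgM (cvgM (cvg_cst a) cP) cI).
Qed.

Let measurable_g (a : R) : measurable_fun pos (g a).
Proof.
apply: open_continuous_measurable_fun; first exact: interval_open.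
by move=> x; rewrite inE/= in_itv/= andbT; exact: continuous_g.
Qed.

(** On ]0, +oo[ the function [G a] is an antiderivative of [g a] with values in [0, 1], so integrals
    over compact subintervals are at most 1; monotone convergence does the rest. *)
Let integral_g_le1 (a : R) : 0 < a ->
  (\int[mu]_(t in pos) (g a t)%:E <= 1)%E.
Proof.
move=> a0.
(* These intervals stay away from 0, where [g a] blows up if a < 1; n + 2 keeps the endpoints
   distinct already for n = 0. *)
pose F n : set R := `[n.+2%:R^-1, n.+2%:R]%classic.
have Fpos n x : F n x -> 0 < x.
  by rewrite /F/= in_itv/= => /andP[nx _]; apply: (lt_le_trans _ nx); rewrite invr_gt0.
have posE : pos = \bigcup_n F n.
  apply/seteqP; split=> [t|t [n _ /Fpos]] /=; rewrite in_itv/= andbT//.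
  move=> t0; pose n := Num.bound (t + t^-1); exists n => //=.
  have : t + t^-1 < n%:R.
    by apply: archi_boundP; rewrite addr_ge0 ?invr_ge0 ?ltW.
  have n2 : (n%:R : R) <= n.+2%:R by rewrite ler_nat (leq_addl 2 n).
  move=> tn; rewrite /F/= in_itv/=; have ti : 0 < t^-1 by rewrite invr_gt0.
  apply/andP; split; last by lra.
  by rewrite -[leRHS]invrK lef_pV2 ?posrE//; lra.
have Fn n : (\int[mu]_(t in F n) (g a t)%:E <= 1)%E.
  have nn : (n.+2%:R^-1 : R) < n.+2%:R.
    by rewrite (@lt_trans _ _ 1) ?invf_lt1 ?ltr1n.
  have n0 : (0 : R) < n.+2%:R^-1 by rewrite invr_gt0.
  have dG x : 0 < x -> {for x, continuous (G a)}.
    move=> x0; apply: differentiable_continuous; apply/derivable1_diffP.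
    by have [//] := is_derive_G a x x0.
  rewrite (continuous_FTC2 (F := G a) nn).
  - rewrite -EFinB lee_fin.
    apply: (@le_trans _ _ (G a n.+2%:R)); first by rewrite gerBl powR_ge0.
    apply: (@le_trans _ _ (1 `^ a)); last by rewrite powR1.
    apply: ge0_ler_powR; rewrite ?nnegrE ?(ltW a0)//.
    by rewrite ltW// ratio_gt0.
  - apply: continuous_in_subspaceT => x; rewrite inE/= => /Fpos.
    exact: continuous_g.
  - split.
    + move=> x; rewrite in_itv/= => /andP[nx _].
      by have [//] := is_derive_G a x (lt_trans n0 nx).
    + exact: (cvg_at_right_filter (dG _ n0)).
    + by apply: cvg_at_left_filter; apply: dG.
  - move=> x; rewrite in_itv/= => /andP[nx _].
    rewrite derive1E; have := is_derive_G a x (lt_trans n0 nx).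
    by move=> dGx; rewrite derive_val.
have mg n : measurable_fun (F n) (fun t => (g a t)%:E).
  apply/measurable_EFinP; apply: (measurable_funS _ _ (measurable_g a)) => //.
  by rewrite posE => x Fx; exists n.
have mF n : measurable (F n) by exact: measurable_itv.
have ndF : nondecreasing_seq F.
  apply/nondecreasing_seqP => n; rewrite subsetEset /F.
  by apply: subset_itv; rewrite leBSide/= ?ler_nat// lef_pV2 ?posrE ?ler_nat.
have g0 n x : F n x -> (0 <= (g a x)%:E)%E by rewrite lee_fin g_ge0// ltW.
have cv : (\int[mu]_(t in F n) (g a t)%:E)%E @[n --> \oo] -->
    (\int[mu]_(t in \bigcup_n F n) (g a t)%:E)%E.
  exact: ge0_nondecreasing_set_cvg_integral.
rewrite posE -(cvg_lim _ cv)//; apply: lime_le; last exact: nearW.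
by apply/cvg_ex; eexists; exact: cv.
Qed.

Lemma integrable_gamma_integrand (a : R) : 0 < a ->
  mu.-integrable pos (EFin \o gamma_integrand a).
Proof.
move=> a0; have [K K0 gK] := gamma_le_g a a0.
apply/integrableP; split.
  by apply/measurable_EFinP; exact: measurable_gamma_integrand.
apply: (@le_lt_trans _ _ (\int[mu]_(t in pos) (K%:E * (g a t)%:E))%E).
  apply: ge0_le_integral => //.
  - apply: measurableT_comp => //.
    by apply/measurable_EFinP; exact: measurable_gamma_integrand.
  - apply/measurable_EFinP; apply: measurable_funM => //.
    exact: measurable_g.
  - move=> t; rewrite /= in_itv/= andbT => t0.
    by rewrite ger0_norm ?gamma_integrand_ge0// lee_fin gK.
rewrite ge0_integralZl_EFin//.
- apply: (@le_lt_trans _ _ (K%:E * 1)%E); last by rewrite mule1 ltry.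
  by apply: lee_wpmul2l; [rewrite lee_fin|exact: integral_g_le1].
- by move=> t _; rewrite lee_fin g_ge0// ltW.
- by apply/measurable_EFinP; exact: measurable_g.
Qed.

End gamma_integral.

(** * Power bounds for the Gamma distribution function and its tail *)

Section gamma_cdf_bounds.
Context {R : realType}.
Local Notation mu := (@lebesgue_measure R).
Local Notation pos := (`]0, +oo[%classic : set R).

(** Source of all lower bounds below: a nonnegative integrand is cut down to one short interval on
    which it is at least a constant. *)
Lemma Rintegral_ge_itv (f : R -> R) (k a b : R) :
  mu.-integrable pos (EFin \o f) -> (forall t, 0 < t -> 0 <= f t) ->
  0 <= a -> a <= b -> (forall t, a < t <= b -> k <= f t) ->
  k * (b - a) <= \int[mu]_(t in pos) f t.
Proof.
move=> fint f0 a0 ab kf.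
have sub : `]a, b]%classic `<=` pos.
  by move=> t /=; rewrite !in_itv/= andbT => /andP[/(le_lt_trans a0)].
have fint' : mu.-integrable `]a, b]%classic (EFin \o f).
  exact: integrableS fint.
apply: (@le_trans _ _ (\int[mu]_(t in `]a, b]%classic) f t)).
  have -> : k * (b - a) = \int[mu]_(t in `]a, b]%classic) (cst k t).
    rewrite Rintegral_cst//= lebesgue_measure_itv/= lte_fin.
    by case: ltgtP ab => // -> _; rewrite subrr mulr0.
  apply: le_Rintegral => //.
  apply/integrableP; split; first exact/measurable_EFinP.
  apply: (@le_lt_trans _ _ (`|k|%:E * mu `]a, b]%classic)%E).
    by rewrite -integral_cst.
  rewrite lebesgue_measure_itv/= lte_fin.
  by case: ifP => _; rewrite ?mule0 ?ltry// -EFinB -EFinM ltry.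
rewrite /Rintegral fine_le//; do ?exact: integrable_fin_num.
apply: ge0_subset_integral => //; first exact: measurable_int fint.
by move=> t; rewrite /= in_itv/= andbT => /f0; rewrite lee_fin.
Qed.

(** Writing t^(a-1) as t^a / t, the numerator is bounded at x and the denominator at y, whatever the
    sign of a - 1. *)
Lemma gamma_integrand_lb (a x y t : R) : 0 < a -> 0 < x -> x < t <= y ->
  x `^ a / y * expR (- y) <= gamma_integrand a t.
Proof.
move=> a0 x0 /andP[xt ty]; have t0 := lt_trans x0 xt.
rewrite ler_pM ?mulr_ge0 ?invr_ge0 ?powR_ge0 ?expR_ge0 ?(ltW (lt_le_trans t0 ty))//.
  rewrite powRB ?(gt_eqF t0) ?implybT// powRr1 ?(ltW t0)//.
  rewrite ler_pM ?invr_ge0 ?powR_ge0 ?(ltW (lt_le_trans t0 ty))//.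
    by rewrite ge0_ler_powR ?nnegrE ?(ltW a0) ?(ltW t0) ?(ltW x0)// ltW.
  by rewrite lef_pV2 ?posrE// (lt_le_trans t0).
by rewrite ler_expR lerN2.
Qed.

Lemma gamma_funE (a : R) :
  gamma_fun a = \int[mu]_(t in pos) gamma_integrand a t.
Proof. by []. Qed.

Lemma integrable_gammaZ (a k : R) : 0 < a ->
  mu.-integrable pos (EFin \o (fun t => k * gamma_integrand a t)).
Proof.
move=> a0.
have h := @integrableZl _ _ _ mu pos (measurable_itv _) k _
  (integrable_gamma_integrand a a0).
exact: h.
Qed.

(** The interval ]1, 2] alone contributes a positive amount. *)
Lemma gamma_fun_gt0 (a : R) : 0 < a -> 0 < gamma_fun a.
Proof.
move=> a0.
apply: (@lt_le_trans _ _ ((1 `^ a / 2 * expR (- 2)) * (2 - 1))).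
  by rewrite powR1 !mulr_gt0 ?expR_gt0 ?subr_gt0 ?ltr1n// invr_gt0.
apply: Rintegral_ge_itv => //.
- exact: integrable_gamma_integrand.
- by move=> t _; exact: gamma_integrand_ge0.
- by rewrite ler1n.
- by move=> t t12; exact: gamma_integrand_lb.
Qed.

Lemma gamma_indic_ge0 (a : R) (A : set R) (t : R) :
  0 <= gamma_integrand a t * \1_A t.
Proof. by apply: mulr_ge0 => //; exact: gamma_integrand_ge0. Qed.

Lemma integrable_gamma_indic (a : R) (A : set R) : 0 < a -> measurable A ->
  mu.-integrable pos (EFin \o (fun t => gamma_integrand a t * \1_A t)).
Proof.
move=> a0 mA; apply: le_integrable (integrable_gamma_integrand a a0) => //.
  apply/measurable_EFinP; apply: measurable_funM.
    exact: measurable_gamma_integrand.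
  exact: measurable_indic.
move=> t _; rewrite lee_fin !ger0_norm ?gamma_indic_ge0 ?gamma_integrand_ge0//.
by rewrite ler_piMr ?gamma_integrand_ge0.
Qed.

(** Moving the cut at x into an indicator puts all integrals on the common domain ]0, +oo[, where
    they can be compared pointwise. *)
Lemma gamma_cdfE (a x : R) : 0 < a -> gamma_cdf a x =
  (\int[mu]_(t in pos) (gamma_integrand a t * \1_(`]-oo, x]) t)) / gamma_fun a.
Proof.
move=> a0; rewrite -RintegralZr//; last exact: integrable_gamma_indic.
rewrite /gamma_cdf /gamma_prob -/(Rintegral _ _ _).
rewrite Rintegral_mkcond [RHS]Rintegral_mkcond; apply: eq_Rintegral => t _.
rewrite /gamma_pdf !patchE indicE /gamma_integrand.
by do 2 case: (_ \in _); rewrite ?mulr1 ?mulr0 ?mul0r.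
Qed.

Lemma gamma_tailE (a x : R) : 0 < a -> 1 - gamma_cdf a x =
  (\int[mu]_(t in pos) (gamma_integrand a t * \1_(`]x, +oo[) t)) / gamma_fun a.
Proof.
move=> a0; have g0 := gamma_fun_gt0 a a0.
apply: (mulIf (lt0r_neq0 g0)); rewrite divfK ?gt_eqF// mulrBl mul1r.
rewrite gamma_cdfE// divfK ?gt_eqF//.
rewrite /gamma_fun -RintegralB//; first last.
- exact: integrable_gamma_indic.
- exact: integrable_gamma_integrand.
apply: eq_Rintegral => t _.
rewrite -/(gamma_integrand a t) !indicE !mem_setE !in_itv/= andbT.
by case: ltP => _; rewrite ?mulr1 ?mulr0 ?subr0 ?subrr.
Qed.

Lemma gamma_cdf_ge0 (a x : R) : 0 < a -> 0 <= gamma_cdf a x.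
Proof.
move=> a0; rewrite gamma_cdfE// divr_ge0 ?(ltW (gamma_fun_gt0 a a0))//.
by apply: Rintegral_ge0 => t _; exact: gamma_indic_ge0.
Qed.

Lemma gamma_tail_ge0 (a x : R) : 0 < a -> 0 <= 1 - gamma_cdf a x.
Proof.
move=> a0; rewrite gamma_tailE// divr_ge0 ?(ltW (gamma_fun_gt0 a a0))//.
by apply: Rintegral_ge0 => t _; exact: gamma_indic_ge0.
Qed.

Lemma gamma_cdf_le1 (a x : R) : 0 < a -> gamma_cdf a x <= 1.
Proof. by move=> a0; rewrite -subr_ge0 gamma_tail_ge0. Qed.

Lemma gamma_cdf_nondecreasing (a : R) : 0 < a ->
  {homo gamma_cdf a : x y / x <= y}.
Proof.
move=> a0 x y xy; rewrite !gamma_cdfE// ler_pM2r ?invr_gt0 ?gamma_fun_gt0//.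
apply: le_Rintegral => //; do ?exact: integrable_gamma_indic.
move=> t _; rewrite ler_wpM2l ?gamma_integrand_ge0// !indicE !mem_setE !in_itv/=.
by have [tx|_] := leP t x => //; rewrite (le_trans tx xy).
Qed.

(* Markov's inequality for the moment of order - c. *)
Lemma gamma_cdf_ub (a c : R) : 0 < c -> c < a ->
  exists2 K, 0 < K & forall x, 0 < x -> gamma_cdf a x <= K * x `^ c.
Proof.
move=> c0 ca; have a0 := lt_trans c0 ca; have g0 := gamma_fun_gt0 a a0.
have ac0 : 0 < a - c by rewrite subr_gt0.
exists (gamma_fun (a - c) / gamma_fun a).
  by rewrite divr_gt0// gamma_fun_gt0.
move=> x x0; rewrite gamma_cdfE// mulrAC ler_pM2r ?invr_gt0// mulrC.
rewrite gamma_funE -RintegralZl//; last exact: integrable_gamma_integrand.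
apply: le_Rintegral => //; first exact: integrable_gamma_indic.
  exact: integrable_gammaZ.
move=> t; rewrite /= in_itv/= andbT => t0.
rewrite indicE mem_setE in_itv/=; case: (leP t x) => tx; last first.
  by rewrite mulr0 !mulr_ge0 ?powR_ge0 ?expR_ge0.
rewrite mulr1 /gamma_integrand mulrA ler_wpM2r ?expR_ge0//.
have -> : a - 1 = c + (a - c - 1) by ring.
rewrite powRD ?(gt_eqF t0) ?implybT// ler_wpM2r ?powR_ge0//.
by apply: ge0_ler_powR; rewrite ?nnegrE ?(ltW c0) ?(ltW t0) ?(ltW x0)//.
Qed.

(** Markov's inequality for the moment of order c: (t / x)^c >= 1 when t > x. The constant K is the
    moment E(G^c) of G ~ Gamma(a, 1). *)
Lemma gamma_tail_ub (a c : R) : 0 < a -> 0 < c ->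
  exists2 K, 0 < K & forall x, 0 < x -> 1 - gamma_cdf a x <= K * x `^ (- c).
Proof.
move=> a0 c0; have g0 := gamma_fun_gt0 a a0.
have ac0 : 0 < a + c by rewrite addr_gt0.
exists (gamma_fun (a + c) / gamma_fun a).
  by rewrite divr_gt0// gamma_fun_gt0.
move=> x x0; rewrite gamma_tailE// mulrAC ler_pM2r ?invr_gt0// mulrC.
rewrite gamma_funE -RintegralZl//; last exact: integrable_gamma_integrand.
apply: le_Rintegral => //; first exact: integrable_gamma_indic.
  exact: integrable_gammaZ.
move=> t; rewrite /= in_itv/= andbT => t0.
rewrite indicE mem_setE in_itv/= andbT; case: (ltP x t) => tx; last first.
  by rewrite mulr0 !mulr_ge0 ?powR_ge0 ?expR_ge0.
rewrite mulr1 /gamma_integrand mulrA ler_wpM2r ?expR_ge0//.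
have -> : a + c - 1 = c + (a - 1) by ring.
rewrite [t `^ (c + _)]powRD ?(gt_eqF t0) ?implybT// mulrA ler_peMl ?powR_ge0//.
rewrite powRN mulrC ler_pdivlMr ?powR_gt0// mul1r.
by apply: ge0_ler_powR; rewrite ?nnegrE ?(ltW c0) ?(ltW t0) ?(ltW x0)// ltW.
Qed.

(** Only ]x / 2, x] is kept: it has length x / 2, and the integrand there is at least (x / 2)^a
    exp(-x) / x, with exp(-x) >= exp(-1). *)
Lemma gamma_cdf_lb (a : R) : 0 < a ->
  exists2 k, 0 < k & forall x, 0 < x -> x <= 1 -> k * x `^ a <= gamma_cdf a x.
Proof.
move=> a0; have g0 := gamma_fun_gt0 a a0.
exists (2^-1 `^ a * expR (- 1) / 2 / gamma_fun a).
  by rewrite !divr_gt0// mulr_gt0 ?powR_gt0 ?expR_gt0 ?invr_gt0.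
move=> x x0 x1; rewrite gamma_cdfE// mulrAC ler_pM2r ?invr_gt0//.
have hx0 : 0 < x / 2 by rewrite divr_gt0.
have hx : x / 2 <= x by rewrite ler_pdivrMr// ler_peMr ?ltW ?ltr1n.
apply: (@le_trans _ _ ((x / 2) `^ a / x * expR (- x) * (x - x / 2))).
  have -> : x - x / 2 = x / 2 by field.
  rewrite powRM ?(ltW x0) ?invr_ge0//.
  have -> : x `^ a * 2^-1 `^ a / x * expR (- x) * (x / 2) =
    2^-1 `^ a * expR (- x) / 2 * x `^ a by field; rewrite gt_eqF.
  do 2 (rewrite ler_wpM2r ?powR_ge0 ?invr_ge0//).
  by rewrite ler_wpM2l ?powR_ge0// ler_expR lerN2.
apply: Rintegral_ge_itv => //.
- exact: integrable_gamma_indic.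
- by move=> t _; exact: gamma_indic_ge0.
- exact: ltW.
- move=> t txx; rewrite indicE mem_setE in_itv/=; case/andP: (txx) => _ ->.
  by rewrite mulr1; exact: gamma_integrand_lb.
Qed.

Lemma gamma_tail1_gt0 (a : R) : 0 < a -> 0 < 1 - gamma_cdf a 1.
Proof.
move=> a0; rewrite gamma_tailE// divr_gt0 ?gamma_fun_gt0//.
apply: (@lt_le_trans _ _ ((1 `^ a / 2 * expR (- 2)) * (2 - 1))).
  by rewrite powR1 !mulr_gt0 ?expR_gt0 ?subr_gt0 ?ltr1n// invr_gt0.
apply: Rintegral_ge_itv => //.
- exact: integrable_gamma_indic.
- by move=> t _; exact: gamma_indic_ge0.
- by rewrite ler1n.
- move=> t t12; rewrite indicE mem_setE in_itv/= andbT.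
  by case/andP: (t12) => -> _; rewrite mulr1; exact: gamma_integrand_lb.
Qed.

End gamma_cdf_bounds.

(** * Probabilities comparing Gamma variables with an exponential one *)

Section gamma_ratio.
Context {R : realType}.
Local Notation mu := (@lebesgue_measure R).
Local Notation pos := (`]0, +oo[%classic : set R).

(** The dominating function exp(-w) is the Gamma integrand of shape 1. *)
Lemma integrable_bounded_expRN (h : R -> R) : measurable_fun pos h ->
  (forall w, 0 < w -> 0 <= h w <= 1) ->
  mu.-integrable pos (EFin \o (fun w => h w * expR (- w))).
Proof.
move=> mh h01; apply: le_integrable (integrable_gamma_integrand 1 ltr01) => //.
  apply/measurable_EFinP; apply: measurable_funM => //.
  apply: measurable_funTS; apply: measurableT_comp => //; exact: oppr_measurable.
move=> w; rewrite /= in_itv/= andbT => /h01/andP[h0 h1].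
rewrite lee_fin /gamma_integrand subrr powRr0 mul1r !ger0_norm ?expR_ge0//.
  by rewrite ler_piMl ?expR_ge0.
by rewrite mulr_ge0 ?expR_ge0.
Qed.

Lemma measurable_gamma_cdf_scale (a x : R) : 0 < a -> 0 < x ->
  measurable_fun pos (fun w => gamma_cdf a (w / x)).
Proof.
move=> a0 x0; apply: nondecreasing_measurable => // w1 w2 w12.
by apply: gamma_cdf_nondecreasing => //; rewrite ler_pM2r ?invr_gt0.
Qed.

Lemma gamma_cdf_01 (a x : R) : 0 < a -> 0 <= gamma_cdf a x <= 1.
Proof. by move=> a0; rewrite gamma_cdf_ge0 ?gamma_cdf_le1. Qed.

Lemma gamma_tail_01 (a x : R) : 0 < a -> 0 <= 1 - gamma_cdf a x <= 1.
Proof. by move=> a0; rewrite gamma_tail_ge0 ?gerBl ?gamma_cdf_ge0. Qed.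

Lemma mulr_01 (p q : R) : 0 <= p <= 1 -> 0 <= q <= 1 -> 0 <= p * q <= 1.
Proof. by move=> /andP[? ?] /andP[? ?]; rewrite mulr_ge0 ?mulr_ile1. Qed.

(* With independent G ~ Gamma(a, 1), H ~ Gamma(b, 1) and W ~ Exp(1), the three
   quantities below are P(G <= W / x, H <= W / y), P(G <= W / x) and
   P(G <= W / x, H > W / y). *)
Definition joint_below (a x b y : R) : R := \int[mu]_(w in pos)
  (gamma_cdf a (w / x) * gamma_cdf b (w / y) * expR (- w)).

Definition marginal_below (a x : R) : R :=
  \int[mu]_(w in pos) (gamma_cdf a (w / x) * expR (- w)).

Definition below_above (a x b y : R) : R := \int[mu]_(w in pos)
  (gamma_cdf a (w / x) * (1 - gamma_cdf b (w / y)) * expR (- w)).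

Lemma integrable_below_above (a x b y : R) : 0 < a -> 0 < x -> 0 < b -> 0 < y ->
  mu.-integrable pos (EFin \o (fun w =>
    gamma_cdf a (w / x) * (1 - gamma_cdf b (w / y)) * expR (- w))).
Proof.
move=> a0 x0 b0 y0; apply: integrable_bounded_expRN.
  apply: measurable_funM; first exact: measurable_gamma_cdf_scale.
  by apply: measurable_funB => //; exact: measurable_gamma_cdf_scale.
exact: (fun w _ => mulr_01 _ _ (gamma_cdf_01 a _ a0) (gamma_tail_01 b _ b0)).
Qed.

Lemma joint_belowE (a x b y : R) : 0 < a -> 0 < x -> 0 < b -> 0 < y ->
  joint_below a x b y = marginal_below a x - below_above a x b y.
Proof.
move=> a0 x0 b0 y0; rewrite -RintegralB//; last exact: integrable_below_above.
  apply: eq_Rintegral => w _.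
  move: (gamma_cdf a _) (gamma_cdf b _) (expR _) => p q r.
  by rewrite mulrBr mulr1 mulrBl opprB addrC subrK.
apply: integrable_bounded_expRN; first exact: measurable_gamma_cdf_scale.
by move=> w _; exact: gamma_cdf_01.
Qed.

Lemma joint_belowC (a x b y : R) : joint_below a x b y = joint_below b y a x.
Proof. apply: eq_Rintegral => w _.
by move: (gamma_cdf a _) (gamma_cdf b _) => p q; rewrite (mulrC p). Qed.

Lemma below_above_ge0 (a x b y : R) : 0 < a -> 0 < b -> 0 <= below_above a x b y.
Proof.
move=> a0 b0; apply: Rintegral_ge0 => w _.
by rewrite mulr_ge0 ?expR_ge0// mulr_ge0 ?gamma_cdf_ge0 ?gamma_tail_ge0.
Qed.

(** The two Markov bounds give a multiple of (w / x)^c (w / y)^(-e) exp(-w). Its integral is y^e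
    times a Gamma integral of shape c - e + 1, which converges because e < c + 1. *)
Lemma below_above_ub (a b c e x : R) : 0 < b -> 0 < c -> c < a ->
    0 < e -> e < c + 1 -> 0 < x ->
  exists2 K, 0 < K & forall y, 0 < y -> below_above a x b y <= K * y `^ e.
Proof.
move=> b0 c0 ca e0 ec x0; have a0 := lt_trans c0 ca.
have [K1 K10 HK1] := gamma_cdf_ub a c c0 ca.
have [K2 K20 HK2] := gamma_tail_ub b e b0 e0.
have d0 : 0 < c - e + 1 by lra.
exists (K1 * K2 * x `^ (- c) * gamma_fun (c - e + 1)).
  by rewrite !mulr_gt0 ?powR_gt0 ?gamma_fun_gt0.
move=> y y0; rewrite mulrAC gamma_funE -RintegralZl//; last first.
  exact: integrable_gamma_integrand.
apply: le_Rintegral => //.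
- exact: integrable_below_above.
- exact: integrable_gammaZ.
move=> w; rewrite /= in_itv/= andbT => w0.
have wx0 : 0 < w / x by rewrite divr_gt0.
have wy0 : 0 < w / y by rewrite divr_gt0.
apply: (@le_trans _ _ ((K1 * (w / x) `^ c) * (K2 * (w / y) `^ (- e)) * expR (- w))).
  rewrite ler_wpM2r ?expR_ge0// ler_pM ?gamma_cdf_ge0 ?gamma_tail_ge0//.
    exact: HK1.
  exact: HK2.
rewrite /gamma_integrand addrK [X in X <= _](_ : _ = K1 * K2 * x `^ (- c) *
  y `^ e * (w `^ (c - e) * expR (- w)))//.
rewrite !powRM ?(ltW w0) ?invr_ge0 ?(ltW x0) ?(ltW y0)//.
rewrite -(powR_inv1 (ltW x0)) -(powR_inv1 (ltW y0)) -!powRrM !mulN1r opprK.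
rewrite powRD ?(gt_eqF w0) ?implybT//.
by move: (w `^ _) (w `^ _) (x `^ _) (y `^ _) (expR _) => p q r s t; ring.
Qed.

(** Restrict W to ]y / 2, y]. There H > W / y has probability at least P(H > 1), and G <= W / x has
    probability of order at least y^a; the length y / 2 supplies the extra power. *)
Lemma below_above_lb (a b x : R) : 0 < a -> 0 < b -> 0 < x ->
  exists2 k, 0 < k & forall y, 0 < y -> y <= 1 -> y <= x ->
    k * y `^ (a + 1) <= below_above a x b y.
Proof.
move=> a0 b0 x0; have [k0 k00 Hk] := gamma_cdf_lb a a0.
have t0 := gamma_tail1_gt0 b b0.
exists (k0 * (2 * x)^-1 `^ a * (1 - gamma_cdf b 1) * expR (- 1) / 2).
  by rewrite divr_gt0// !mulr_gt0 ?expR_gt0 ?powR_gt0// invr_gt0 mulr_gt0.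
move=> y y0 y1 yx.
have y20 : 0 < y / 2 by rewrite divr_gt0.
apply: (@le_trans _ _ (k0 * (y / 2 / x) `^ a * (1 - gamma_cdf b 1) *
    expR (- 1) * (y - y / 2))).
  rewrite powRD ?(gt_eqF y0) ?implybT// powRr1 ?(ltW y0)//.
  have -> : y / 2 / x = y * (2 * x)^-1 by field; rewrite gt_eqF.
  rewrite powRM ?(ltW y0) ?invr_ge0 ?mulr_ge0 ?(ltW x0)//.
  move: (gamma_cdf b 1) (expR _) (y `^ a) (_ `^ a) => p q r s.
  by rewrite le_eqVlt; apply/orP; left; apply/eqP; field.
apply: Rintegral_ge_itv.
- exact: integrable_below_above.
- move=> w _; rewrite mulr_ge0 ?expR_ge0// mulr_ge0 ?gamma_cdf_ge0//.
  exact: gamma_tail_ge0.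
- exact: ltW.
- by lra.
- move=> w /andP[yw wy]; have w0 := lt_trans y20 yw.
  rewrite ler_pM ?expR_ge0 ?mulr_ge0 ?powR_ge0 ?(ltW k00) ?(ltW t0)//; last first.
    by rewrite ler_expR lerN2; lra.
  rewrite ler_pM ?mulr_ge0 ?powR_ge0 ?(ltW k00) ?(ltW t0)//.
    apply: (@le_trans _ _ (gamma_cdf a (y / 2 / x))).
      (* The bound y <= x puts y / 2 / x in ]0, 1], the range of [gamma_cdf_lb]. *)
      by apply: Hk; rewrite ?divr_gt0// ler_pdivrMr//; lra.
    by apply: gamma_cdf_nondecreasing => //; rewrite ler_pM2r ?invr_gt0// ltW.
  rewrite lerB//; apply: gamma_cdf_nondecreasing => //.
  by rewrite ler_pdivrMr// mul1r.
Qed.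

End gamma_ratio.

(** * Orders of the joint terms as t tends to 0, and asymmetry of the copula *)

Section asymmetry.
Context {R : realType}.
Local Notation mu := (@lebesgue_measure R).

Lemma le_powR_small_le0 (d K e : R) : 0 < e ->
  (forall t, 0 < t -> t <= 1 -> d <= K * t `^ e) -> d <= 0.
Proof.
move=> e0 dK; rewrite leNgt; apply/negP => d0.
have K0 : 0 < K.
  have := dK 1 ltr01 (lexx _); rewrite powR1 mulr1; exact: lt_le_trans.
(* A point t with t^e <= r yields d <= K r = d / 2, which is absurd for d > 0. *)
pose r := d / (2 * K).
have r0 : 0 < r by rewrite divr_gt0 ?mulr_gt0.
have re0 : 0 < r `^ e^-1 by rewrite powR_gt0.
pose t := Num.min 1 (r `^ e^-1).
have t0 : 0 < t by rewrite lt_min ltr01 re0.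
have t1 : t <= 1 by rewrite ge_min lexx.
have tr : t `^ e <= r.
  have <- : (r `^ e^-1) `^ e = r by rewrite -powRrM mulVf ?gt_eqF// powRr1 ?ltW.
  apply: ge0_ler_powR; rewrite ?nnegrE ?(ltW e0) ?(ltW t0) ?(ltW re0)//.
  by rewrite ge_min lexx orbT.
have : d <= K * r by apply: le_trans (dK t t0 t1) _; rewrite ler_pM2l.
have -> : K * r = d / 2 by rewrite /r; field; rewrite gt_eqF.
by move: d0; lra.
Qed.

(** The value of (1 - u)^(-1/a) - 1 at u = 1 - exp(-t). *)
Definition scale (a t : R) : R := expR (t / a) - 1.

Lemma scale_gt0 (a t : R) : 0 < a -> 0 < t -> 0 < scale a t.
Proof. by move=> a0 t0; rewrite subr_gt0 expR_gt1 divr_gt0. Qed.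

Lemma scale_lb (a t : R) : 0 < a -> t / a <= scale a t.
Proof. by move=> a0; rewrite lerBrDl expR_ge1Dx. Qed.

(** With p = t / a, multiplying 1 - p <= exp(-p) by exp(p) gives exp(p) - 1 <= p exp(p), and p <= 1
    / a bounds the remaining exponential. *)
Lemma scale_ub (a t : R) : 0 < a -> 0 < t -> t <= 1 ->
  scale a t <= expR a^-1 / a * t.
Proof.
move=> a0 t0 t1; rewrite /scale.
have h : 1 - t / a <= expR (- (t / a)) by rewrite expR_ge1Dx.
have h1 : expR (t / a) * (1 - t / a) <= 1.
  by rewrite (le_trans (ler_wpM2l (expR_ge0 _) h))// expRxMexpNx_1.
have h2 : expR (t / a) * (t / a) <= expR a^-1 * (t / a).
  by rewrite ler_wpM2r ?divr_ge0 ?(ltW t0) ?(ltW a0)// ler_expR ler_piMl// invr_ge0 ltW.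
rewrite -mulrA [a^-1 * t]mulrC; apply: le_trans h2.
by move: h1; rewrite mulrBr mulr1; move: (expR _) => p; lra.
Qed.

Lemma below_above_scale_ub (a b c e x : R) : 0 < b -> 0 < c -> c < a ->
    0 < e -> e < c + 1 -> 0 < x ->
  exists2 K, 0 < K & forall t, 0 < t -> t <= 1 ->
    below_above a x b (scale b t) <= K * t `^ e.
Proof.
move=> b0 c0 ca e0 ec x0.
have [K K0 HK] := below_above_ub a b c e x b0 c0 ca e0 ec x0.
have m0 : 0 < expR b^-1 / b by rewrite divr_gt0 ?expR_gt0.
exists (K * (expR b^-1 / b) `^ e); first by rewrite mulr_gt0 ?powR_gt0.
move=> t t0 t1; have s0 := scale_gt0 b t b0 t0.
apply: le_trans (HK _ s0) _; rewrite -mulrA -powRM ?(ltW t0) ?(ltW m0)//.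
rewrite ler_pM2l//; apply: ge0_ler_powR; rewrite ?nnegrE ?(ltW e0) ?(ltW s0)//.
  by rewrite mulr_ge0 ?ltW.
exact: scale_ub.
Qed.

Lemma below_above_scale_small (a b x d : R) : 0 < a -> 0 < b -> 0 < x ->
  (forall t, 0 < t -> t <= 1 -> d <= below_above a x b (scale b t)) -> d <= 0.
Proof.
move=> a0 b0 x0 dD.
(* Any positive power of t suffices here; c = a / 2 and e = 1 / 2 are admissible for every a > 0. *)
have [|||||K K0 HK] // := below_above_scale_ub a b (a / 2) 2^-1 x b0; try lra.
apply: (@le_powR_small_le0 d K 2^-1); first by lra.
by move=> t t0 t1; apply: le_trans (dD t t0 t1) (HK t t0 t1).
Qed.

(* The left-hand side is O(t^(a + d + 1)) for some d > 0, the right-hand side is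
   at least of order t^(a + 1). *)
Lemma below_above_asym (a b x y : R) : 0 < a -> a < b -> 0 < x -> 0 < y ->
  ~ (forall t, 0 < t -> t <= 1 ->
      below_above b y a (scale a t) = below_above a x b (scale b t)).
Proof.
move=> a0 ab x0 y0 E; have b0 := lt_trans a0 ab.
(* The gap b - a = 3 d leaves room for c = a + 2 d < b and then e = a + d + 1 < c + 1. *)
pose d := (b - a) / 3.
have d0 : 0 < d by rewrite /d; lra.
have [|||||K K0 HK] // :=
  below_above_scale_ub b a (a + 2 * d) (a + d + 1) y a0; try (rewrite /d; lra).
have [k k0 Hk] := below_above_lb a b x a0 b0 x0.
have m0 : 0 < expR b^-1 / b by rewrite divr_gt0 ?expR_gt0.
(* For u = t0 t with t in ]0, 1], [scale_ub] gives [scale b u] at most min(1, x), the range where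
   the lower bound applies. *)
pose t0 := Num.min 1 (Num.min 1 x / (expR b^-1 / b)).
have mx0 : 0 < Num.min 1 x by rewrite lt_min ltr01 x0.
have t00 : 0 < t0 by rewrite lt_min ltr01 divr_gt0.
have t01 : t0 <= 1 by rewrite ge_min lexx.
suff : k * b^-1 `^ (a + 1) * t0 `^ (a + 1) <= 0.
  by rewrite leNgt !mulr_gt0 ?powR_gt0 ?invr_gt0.
apply: (@le_powR_small_le0 _ (K * t0 `^ (a + d + 1)) d) => // t tp t1.
pose u := t0 * t.
have u0 : 0 < u by rewrite mulr_gt0.
have u1 : u <= 1 by apply: mulr_ile1 => //; exact: ltW.
have s0 := scale_gt0 b u b0 u0.
have smin : scale b u <= Num.min 1 x.
  apply: le_trans (scale_ub b u b0 u0 u1) _.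
  rewrite mulrC -ler_pdivlMr//; apply: (@le_trans _ _ t0).
    by rewrite ler_piMr// ltW.
  by rewrite ge_min lexx orbT.
have /andP[s1 sx] : (scale b u <= 1) && (scale b u <= x).
  by move: smin; rewrite le_min.
have lo : k * (u / b) `^ (a + 1) <= K * u `^ (a + d + 1).
  apply: le_trans (HK u u0 u1); rewrite E//.
  apply: le_trans (Hk _ s0 s1 sx); rewrite ler_pM2l//.
  apply: ge0_ler_powR; rewrite ?nnegrE ?(ltW s0) ?divr_ge0 ?(ltW u0) ?(ltW b0)//.
    by rewrite addr_ge0 ?ltW.
  exact: scale_lb.
have tp0 : 0 < t `^ (a + 1) by rewrite powR_gt0.
(* Multiplication by t^(a+1) turns the two sides into the lower and upper bounds at u compared in
   [lo]. *)
rewrite -(ler_pM2r tp0).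
apply: le_trans (_ : k * (u / b) `^ (a + 1) <= _); last apply: le_trans lo _.
  rewrite !powRM ?invr_ge0 ?(ltW u0) ?(ltW b0) ?(ltW t00) ?(ltW tp)//.
  move: (b^-1 `^ _) (t0 `^ (a + 1)) (t `^ _) => p q r.
  by rewrite le_eqVlt; apply/orP; left; apply/eqP; ring.
have -> : a + d + 1 = d + (a + 1) by ring.
rewrite powRM ?(ltW t00) ?(ltW tp)//.
rewrite [t `^ (d + _)]powRD ?(gt_eqF tp) ?implybT//.
by rewrite !mulrA.
Qed.

Lemma marginal_below_asym (a b x y : R) : 0 < a -> 0 < b -> a <> b ->
  0 < x -> 0 < y ->
  ~ (forall t, 0 < t -> t <= 1 ->
      marginal_below a x - below_above a x b (scale b t) =
      marginal_below b y - below_above b y a (scale a t)).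
Proof.
move=> a0 b0 nab x0 y0 E.
(* By [E] and nonnegativity, each difference of marginals is at most a joint term, hence at most 0
   in the limit. *)
have Mab : marginal_below a x = marginal_below b y.
  apply/eqP; rewrite eq_le; apply/andP; split; rewrite -subr_le0.
    apply: (below_above_scale_small a b x) => // t t0 t1.
    have := E t t0 t1.
    have := below_above_ge0 b y a (scale a t) b0 a0.
    move: (marginal_below a x) (marginal_below b y) (below_above a _ _ _).
    by move: (below_above b _ _ _) => p q r s; lra.
  apply: (below_above_scale_small b a y) => // t t0 t1.
  have := E t t0 t1.
  have := below_above_ge0 a x b (scale b t) a0 b0.
  move: (marginal_below a x) (marginal_below b y) (below_above a _ _ _).
  by move: (below_above b _ _ _) => p q r s; lra.
have E' t : 0 < t -> t <= 1 ->
    below_above b y a (scale a t) = below_above a x b (scale b t).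
  move=> t0 t1; have := E t t0 t1; rewrite Mab.
  move: (marginal_below b y) (below_above a _ _ _) (below_above b _ _ _).
  by move=> m p q /addrI/oppr_inj.
have [ab|ba|//] := ltgtP a b; first exact: (below_above_asym a b x y a0 ab x0 y0 E').
apply: (below_above_asym b a y x b0 ba y0 x0).
exact: (fun t t0 t1 => esym (E' t t0 t1)).
Qed.

Lemma two_component_copula_expR (a b s t : R) : 0 < a -> 0 < b ->
    0 < s -> 0 < t ->
  two_component_copula a b (1 - expR (- s)) (1 - expR (- t)) =
  (1 - expR (- s)) + (1 - expR (- t)) - 1 +
    joint_below a (scale a s) b (scale b t).
Proof.
move=> a0 b0 s0 t0.
have eN01 (r : R) : 0 < r -> 0 < 1 - expR (- r) < 1.
  by move=> r0; rewrite subr_gt0 expR_lt1 oppr_lt0 r0 gtrBl expR_gt0.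
have S c r : (1 - (1 - expR (- r))) `^ (- c^-1) - 1 = scale c r.
  by rewrite subKr -expRM mulrNN.
(* The copula integrates over [0, +oo[ and [joint_below] over ]0, +oo[; the endpoint is a null
   set. *)
have <- : \int[mu]_(w in `[0%R, +oo[) (gamma_cdf a (w / scale a s) *
    gamma_cdf b (w / scale b t) * expR (- w)) = joint_below a (scale a s) b (scale b t).
  rewrite /joint_below Rintegral_itv_obnd_cbnd; first by [].
  apply: integrable_bounded_expRN.
    by apply: measurable_funM; apply: measurable_gamma_cdf_scale => //;
      exact: scale_gt0.
  exact: (fun w _ => mulr_01 _ _ (gamma_cdf_01 a _ a0) (gamma_cdf_01 b _ b0)).
rewrite /two_component_copula ifT; last by rewrite (eN01 s s0) (eN01 t t0).
by rewrite !S.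
Qed.

Lemma two_component_copula_asym (a b : R) : 0 < a -> 0 < b -> a <> b ->
  ~ (forall u v : R, u \in `[0%R, 1%R] -> v \in `[0%R, 1%R] ->
       two_component_copula a b u v = two_component_copula a b v u).
Proof.
move=> a0 b0 nab sym.
(* One argument of the copula is frozen at 1 - exp(-1), that is s = 1; the other varies with t. *)
have Ha := scale_gt0 a 1 a0 ltr01; have Hb := scale_gt0 b 1 b0 ltr01.
apply: (marginal_below_asym a b _ _ a0 b0 nab Ha Hb) => t t0 t1.
have u01 (r : R) : 0 < r -> 1 - expR (- r) \in `[0%R, 1%R].
  by move=> r0; rewrite in_itv/= subr_ge0 expR_le1 oppr_le0 (ltW r0) gerBl expR_ge0.
have := sym _ _ (u01 1 ltr01) (u01 t t0).
rewrite (two_component_copula_expR a b 1 t a0 b0 ltr01 t0).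
rewrite (two_component_copula_expR a b t 1 a0 b0 t0 ltr01).
have sa := scale_gt0 a t a0 t0; have sb := scale_gt0 b t b0 t0.
rewrite (joint_belowC a (scale a t)).
rewrite (joint_belowE a _ b _ a0 Ha b0 sb) (joint_belowE b _ a _ b0 Hb a0 sa).
rewrite [X in X - 1 + _ = _]addrC.
exact: (@addrI _ _ _ _).
Qed.

End asymmetry.

(** * Symmetry of Archimedean and Gaussian copulas *)

Section symmetric_families.
Context {R : realType}.
Local Notation mu := (@lebesgue_measure R).

Lemma archimedean_sym (C : R -> R -> R) : is_archimedean_copula C ->
  forall u v, u \in `[0%R, 1%R] -> v \in `[0%R, 1%R] -> C u v = C v u.
Proof. by move=> [phi [_ HC]] u v u01 v01; rewrite !HC// addeC. Qed.

Lemma binormal_pdfC (rho s t : R) : binormal_pdf rho s t = binormal_pdf rho t s.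
Proof.
rewrite /binormal_pdf.
suff -> : s ^+ 2 - 2 * rho * s * t + t ^+ 2 = t ^+ 2 - 2 * rho * t * s + s ^+ 2 by [].
by ring.
Qed.

Lemma binormal_pdf_ge0 (rho s t : R) : 0 <= binormal_pdf rho s t.
Proof.
by rewrite mulr_ge0 ?expR_ge0// invr_ge0 !mulr_ge0 ?pi_ge0 ?sqrtr_ge0.
Qed.

Lemma measurable_binormal_pdf (rho : R) :
  measurable_fun [set: R * R] (fun z => binormal_pdf rho z.1 z.2).
Proof.
apply: measurable_funM => //; apply: measurableT_comp => //.
apply: measurable_funN; apply: measurable_funM => //.
have m1 : measurable_fun [set: R * R] (@fst R R) by exact: measurable_fst.
have m2 : measurable_fun [set: R * R] (@snd R R) by exact: measurable_snd.
apply: measurable_funD; last exact: measurable_funX.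
apply: measurable_funB; first exact: measurable_funX.
by do 2 (apply: measurable_funM => //).
Qed.

(** Tonelli's theorem on the whole plane, applied to the extension of [f] by zero outside B x A. *)
Lemma integral_setX_swap (A B : set R) (f : R -> R -> \bar R) :
  measurable A -> measurable B -> (forall s t, 0 <= f s t)%E ->
  measurable_fun [set: R * R] (fun z => f z.1 z.2) ->
  (\int[mu]_(t in A) \int[mu]_(s in B) f s t =
   \int[mu]_(s in B) \int[mu]_(t in A) f s t)%E.
Proof.
move=> mA mB f0 mf.
pose g (z : R * R) : \bar R := ((fun z => f z.1 z.2) \_ (B `*` A)) z.
have mg : measurable_fun setT g.
  apply/(measurable_restrictT _ _).1; first exact: measurableX.
  exact: measurable_funTS.
have g0 z : (0 <= g z)%E by rewrite /g patchE; case: ifP.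
have := @fubini_tonelli _ _ _ _ R mu mu g mg g0.
have gE s t : g (s, t) = if (s \in B) && (t \in A) then f s t else 0%E.
  by rewrite /g patchE/= in_setX.
move=> E; rewrite [LHS]integral_mkcond [RHS]integral_mkcond.
transitivity (\int[mu]_t \int[mu]_s g (s, t))%E; last rewrite -E.
- apply: eq_integral => t _; rewrite patchE; case: ifPn => tA.
    rewrite integral_mkcond; apply: eq_integral => s _.
    by rewrite gE patchE tA andbT.
  by rewrite integral0_eq// => s _; rewrite gE (negbTE tA) andbF.
- apply: eq_integral => s _; rewrite patchE; case: ifPn => sB.
    rewrite [RHS]integral_mkcond; apply: eq_integral => t _.
    by rewrite gE patchE sB.
  by rewrite integral0_eq// => t _; rewrite gE (negbTE sB).
Qed.

(** Exchanging the order of integration makes the two variables trade ranges, and the density is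
    symmetric in them. *)
Lemma gaussian_sym (C : R -> R -> R) : is_gaussian_copula C ->
  forall u v, u \in `[0%R, 1%R] -> v \in `[0%R, 1%R] -> C u v = C v u.
Proof.
move=> [rho _ HC] u v u01 v01; apply: EFin_inj.
rewrite (HC u v u01 v01) (HC v u v01 u01).
have mq (q : \bar R) : measurable [set t : R | (t%:E <= q)%E].
  by rewrite -[X in measurable X]setTI; apply: measurable_lee.
have pdf_ge0 s t : (0 <= (binormal_pdf rho s t)%:E)%E.
  by rewrite lee_fin binormal_pdf_ge0.
have mpdf : measurable_fun [set: R * R] (fun z => (binormal_pdf rho z.1 z.2)%:E).
  by apply/measurable_EFinP; exact: measurable_binormal_pdf.
rewrite (integral_setX_swap _ _ _ (mq _) (mq _) pdf_ge0 mpdf).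
by do 2 (apply: eq_integral => ? _); rewrite binormal_pdfC.
Qed.

End symmetric_families.

Theorem mainTheorem2 (R : realType) (a1 a2 : R)
    (a1_gt0 : 0 < a1) (a2_gt0 : 0 < a2) (neq_a12 : a1 <> a2) :
  let C : R -> R -> R := two_component_copula a1 a2 in
  [/\ ~ (forall u v : R, u \in `[0%R, 1%R] -> v \in `[0%R, 1%R] ->
           C u v = C v u),
      ~ is_archimedean_copula C
    & ~ is_gaussian_copula C].
Proof.
move=> C; have asym := two_component_copula_asym a1 a2 a1_gt0 a2_gt0 neq_a12.
by split=> [|/archimedean_sym|/gaussian_sym]; exact: asym.
Qed.
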